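(* For every $n \ge 1$ and every $k = O(\log\log n)$, every $n$-vertex tree admits a shortcutting with hop-diameter $k$ and treewidth $O(k\log^{2/k} n)$ for even $k$, and $O\!\left(k\left(\frac{\log n}{\log\log n}\right)^{2/(k-1)}\right)$ for odd $k \ge 3$.
   Context: Let $T=(V,E)$ be a tree (with nonnegative edge lengths) and $d_T$ its shortest-path metric. A shortcutting of $T$ with hop-diameter $k$ is a graph $G=(V,E')$, where each edge $(x,y)\in E'$ has length $d_T(x,y)$, such that for every $u,v\in V$ there is a path in $G$ between $u$ and $v$ with at most $k$ edges whose length equals $d_T(u,v)$ (equivalently, a 1-spanner of the tree metric with hop-diameter $k$). Treewidth is the standard graph parameter. Logarithms are base 2. *)

(* Defs.v *)
From HB Require Import structures.
From mathcomp Require Import all_boot all_order all_algebra.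
From mathcomp Require Import all_classical all_reals all_analysis.

Set Implicit Arguments.
Unset Strict Implicit.
Unset Printing Implicit Defensive.

Import Order.TTheory GRing.Theory Num.Theory.
Local Open Scope ring_scope.

Section Graphs.
Variable V : finType.
Implicit Type e : rel V.

Definition simple_graph e : Prop := symmetric e /\ irreflexive e.

(* [x :: p] lists the vertices, so the path has [size p] edges. *)
Definition simple_path e (x y : V) (p : seq V) : bool :=
  [&& path e x p, last x p == y & uniq (x :: p)].

(* A cycle of a simple graph has at least 3 vertices: in a symmetric relation,
   [ucycle] also accepts [:: x; y] for every edge xy. *)
Definition acyclic e : Prop :=
  forall c : seq V, (2 < size c)%N -> ~ ucycle e c.

Definition is_tree e : Prop :=
  [/\ simple_graph e, (0 < #|V|)%N, (forall x y, connect e x y) & acyclic e].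

End Graphs.

Section Treewidth.

Definition tree_decomposition (V : finType) (e : rel V)
    (I : finType) (t : rel I) (B : I -> {set V}) : Prop :=
  [/\ is_tree t,
      (forall v, exists i, v \in B i),
      (forall u v, e u v -> exists i, (u \in B i) && (v \in B i)) &
      (forall v i j, v \in B i -> v \in B j ->
         connect [rel a b | [&& t a b, v \in B a & v \in B b]] i j)].

Definition decomposition_width (V I : finType) (B : I -> {set V}) : nat :=
  (\max_i #|B i|).-1.

Definition has_decomposition_of_width (V : finType) (e : rel V) (w : nat) :=
  exists (I : finType) (t : rel I) (B : I -> {set V}),
    tree_decomposition e t B /\ decomposition_width B = w.

Lemma ex_decomposition_width (V : finType) (e : rel V) :
  exists w, `[< has_decomposition_of_width e w >].
Proof.
exists (decomposition_width (fun _ : unit => [set: V])); apply/asboolP.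
exists unit, (fun _ _ => false), (fun=> [set: V]); split=> //.
split.
- split; [by split | by rewrite card_unit | |].
  + by move=> [] []; exact: connect0.
  + by case=> [//|[] [//|[] c]] _ /andP[].
- by move=> v; exists tt; rewrite inE.
- by move=> u v _; exists tt; rewrite !inE.
- by move=> v [] [] _ _; exact: connect0.
Qed.

Definition treewidth (V : finType) (e : rel V) : nat :=
  ex_minn (ex_decomposition_width e).

End Treewidth.

Section Shortcuttings.
Variables (R : realType) (V : finType).

Definition path_length (w : V -> V -> R) (x : V) (p : seq V) : R :=
  \sum_(a <- zip (x :: p) p) w a.1 a.2.

Definition edge_lengths (e : rel V) (w : V -> V -> R) : Prop :=
  forall x y, e x y -> w x y = w y x /\ 0 <= w x y.

Definition graph_dist (e : rel V) (w : V -> V -> R) (x y : V) : R :=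
  inf [set path_length w x p | p in [set p : seq V | simple_path e x y p]]%classic.

Definition shortcutting (e : rel V) (w : V -> V -> R) (k : nat) (g : rel V) :
    Prop :=
  simple_graph g /\
  forall u v, exists p,
    [/\ simple_path g u v p, (size p <= k)%N &
        path_length (graph_dist e w) u p = graph_dist e w u v].

End Shortcuttings.

Definition log2 (R : realType) (x : R) : R := ln x / ln 2.

(* For n <= 2 the iterated logarithm is undefined or 0, so it is truncated
   below at 1; this affects only n <= 3. *)
Definition loglog (R : realType) (n : nat) : R :=
  Num.max 1 (log2 (log2 (n%:R : R))).

(* Main.v *)
(* Root the tree and call a vertex set closed if it contains the lowest common
   ancestors of its pairs. In a closed set A one can choose a closed S of size
   at most (q - 1)^2 such that every component of A \ S has at most |A| / q
   vertices; a component is adjacent to at most two vertices of S, and these two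
   are neighbours in S. Shortcut S with k hops, join every vertex of a component
   to the boundary vertices of the component, and recurse inside the components
   with the same q: after j levels, closed sets of size q^j have k + 2 hops and
   treewidth w + 2j, where w is the treewidth for k hops and (q - 1)^2 vertices.
   Iterating this m times, each time with about 2l levels, shortcuts b^(2 l^m)
   vertices with 2m more hops and 4ml more width. One starts from a single vertex
   (0 hops) for even k, and from a clique on b^2 vertices (1 hop) for odd k, where
   b^2 and l are both of order (log n / loglog n)^(1/m). *)
Require Import Defs.
From mathcomp Require Import all_boot all_order all_algebra.
From mathcomp Require Import zify.
Import Order.TTheory GRing.Theory Num.Theory.

Set Implicit Arguments.
Unset Strict Implicit.
Unset Printing Implicit Defensive.

(** * Unique paths, betweenness and medians in a tree *)

Section TreePaths.
Local Open Scope nat_scope.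
Variables (V : finType) (e : rel V).
Hypothesis tree_e : is_tree e.

Let e_sym : symmetric e. Proof. by case: tree_e => -[]. Qed.

Lemma simple_path_cons x y a p :
  simple_path e x y (a :: p) =
  [&& e x a, x \notin a :: p & simple_path e a y p].
Proof. by rewrite /simple_path /=; case: (e x a) (x \notin _) => -[]; rewrite ?andbF. Qed.

Lemma simple_path_nil_uniq x y p :
  simple_path e x y [::] -> simple_path e x y p -> p = [::].
Proof.
case/and3P=> _ /eqP /= <- _; case: p => // a p /and3P[_ /eqP /= lastx].
by case/andP; rewrite -{1}lastx mem_last.
Qed.

Lemma rev_belast_path a p :
  path e a p -> path e (last a p) (rev (belast a p)).
Proof. by rewrite rev_path (eq_path (e' := e)) // => u v; rewrite e_sym. Qed.

Lemma last_rev_belast (a : V) p : last (last a p) (rev (belast a p)) = a.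
Proof. by case: p => //= b p; rewrite rev_cons last_rcons. Qed.

Lemma simple_path_uniq x y p q :
  simple_path e x y p -> simple_path e x y q -> p = q.
Proof.
elim: p x q => [|a p IH] x [|b q] P Q //.
- by rewrite (simple_path_nil_uniq P Q).
- by rewrite (simple_path_nil_uniq Q P).
move: P Q; rewrite !simple_path_cons.
case/and3P=> xa xNp P /and3P[xb xNq Q].
have [eab|neq_ab] := eqVneq a b.
  by move: Q; rewrite -eab => Q; congr (_ :: _); apply: IH P Q.
(* Otherwise [a] and [b] are joined by a walk avoiding [x]; closing it up
   through [x] gives a cycle. *)
have [[Pp /eqP lp _] [Pq /eqP lq _]] := (and3P P, and3P Q).
pose W := p ++ rev (belast b q).
have PW : path e a W.
  by rewrite cat_path Pp lp -lq rev_belast_path.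
have lW : last a W = b by rewrite last_cat lp -lq last_rev_belast.
have xNW : x \notin a :: W.
  rewrite -cat_cons mem_cat negb_or xNp mem_rev.
  by apply: contra xNq => /mem_belast.
move: lW; case/shortenP: PW => W' PW' uW' sW' lW'.
case: tree_e => _ _ _ acyc; exfalso; apply: (acyc (x :: a :: W')).
  by case: W' lW' {PW' uW' sW'} => //= eab; rewrite eab eqxx in neq_ab.
rewrite /ucycle cons_uniq uW' /= xa rcons_path PW' lW' e_sym xb /=.
by rewrite andbT; apply: contra xNW; rewrite !inE => /orP[->//|/sW' ->]; rewrite orbT.
Qed.

Lemma ex_simple_path x y : exists p, simple_path e x y p.
Proof.
case: tree_e => _ _ conn _; case/connectP: (conn x y) => p Pp ->.
by case/shortenP: Pp => p' Pp' up' _; exists p'; rewrite /simple_path Pp' up' eqxx.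
Qed.

Definition tpath x y : seq V := xchoose (ex_simple_path x y).

Lemma tpathP x y : simple_path e x y (tpath x y).
Proof. exact: xchooseP. Qed.

Lemma tpath_eq x y p : simple_path e x y p -> tpath x y = p.
Proof. exact: simple_path_uniq (tpathP x y). Qed.

Lemma last_tpath x y : last x (tpath x y) = y.
Proof. by case/and3P: (tpathP x y) => _ /eqP. Qed.

Lemma uniq_tpath x y : uniq (x :: tpath x y).
Proof. by case/and3P: (tpathP x y). Qed.

Lemma tpathxx x : tpath x x = [::].
Proof. by apply: tpath_eq; rewrite /simple_path /= eqxx. Qed.

Definition btw u x v := x \in u :: tpath u v.

Lemma btw_left u v : btw u u v.
Proof. exact: mem_head. Qed.

Lemma btw_right u v : btw u v v.
Proof. by rewrite /btw -{1}(last_tpath u v) mem_last. Qed.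

Lemma mem_tpath x y : x != y -> y \in tpath x y.
Proof. by move=> nxy; have := btw_right x y; rewrite /btw inE eq_sym (negPf nxy). Qed.

Lemma btw_same u x : btw u x u = (x == u).
Proof. by rewrite /btw tpathxx mem_seq1. Qed.

Lemma tpath_cat u x v : btw u x v -> tpath u v = tpath u x ++ tpath x v.
Proof.
rewrite /btw => xuv.
case/and3P: (tpathP u v); case/splitPl: xuv => p1 p2 lp1.
rewrite cat_path last_cat -cat_cons cat_uniq lp1.
case/andP=> P1 P2 L /and3P[U1 N U2]; congr (_ ++ _); symmetry; apply: tpath_eq.
  by rewrite /simple_path P1 lp1 eqxx U1.
rewrite /simple_path P2 L /= U2 andbT.
apply: contra N => xp2; apply/hasP; exists x => //.
by rewrite /= -lp1 mem_last.
Qed.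

Lemma tpath_catP u x v :
  (forall z, btw u z x -> btw x z v -> z = x) ->
  tpath u v = tpath u x ++ tpath x v.
Proof.
move=> sep; apply: tpath_eq.
case/and3P: (tpathP u x) (tpathP x v) => P1 /eqP L1 U1 /and3P[P2 L2 U2].
move: (U2); rewrite cons_uniq => /andP[xN2 U2'].
have N : ~~ has (mem (u :: tpath u x)) (tpath x v).
  apply/hasPn => z z2; apply/negP => z1.
  have zxv : btw x z v by rewrite /btw inE z2 orbT.
  by move: z2; rewrite (sep z z1 zxv) (negPf xN2).
by rewrite /simple_path cat_path last_cat L1 P1 P2 L2 -cat_cons cat_uniq U1 N.
Qed.

Lemma btw_cat u x v z : btw u x v -> btw u z v = btw u z x || btw x z v.
Proof.
move=> xuv; rewrite /btw (tpath_cat xuv) -cat_cons mem_cat [z \in x :: _]inE.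
case: eqVneq => [->|]//=; by rewrite -/(btw u x x) btw_right.
Qed.

Lemma btw_cat_inter u x v z : btw u x v -> btw u z x -> btw x z v -> z = x.
Proof.
move=> xuv zux; have := uniq_tpath u v.
rewrite (tpath_cat xuv) -cat_cons cat_uniq => /and3P[_ /hasPn N _].
by rewrite /btw inE => /orP[/eqP//|/N /negP].
Qed.

Lemma btw_sym u x v : btw u x v = btw v x u.
Proof.
rewrite /btw.
suff -> : tpath v u = rev (belast u (tpath u v)).
  by rewrite lastI last_tpath mem_rcons !in_cons mem_rev.
apply: tpath_eq; case/and3P: (tpathP u v) => P _ U.
move: (last_tpath u v) (rev_belast_path P) (last_rev_belast u (tpath u v)).
move=> L; rewrite L /simple_path => -> ->.
by rewrite -[X in X :: _]L -rev_rcons -lastI rev_uniq U eqxx.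
Qed.

(** Shortening the walk through [w] to a simple path yields [tpath u v], so every vertex of the
    latter comes from the walk. *)
Lemma btw_triangle u w v x : btw u x v -> btw u x w || btw w x v.
Proof.
have [[P1 /eqP L1 _] [P2 /eqP L2 _]] := (and3P (tpathP u w), and3P (tpathP w v)).
have PW : path e u (tpath u w ++ tpath w v) by rewrite cat_path P1 L1.
have : last u (tpath u w ++ tpath w v) = v by rewrite last_cat L1.
case/shortenP: PW => p P U S L.
rewrite {1}/btw (tpath_eq (p := p)); last by rewrite /simple_path P L eqxx U.
rewrite inE => /orP[/eqP->|/S]; first by rewrite btw_left.
by rewrite mem_cat /btw !inE => /orP[]->; rewrite !orbT.
Qed.

Lemma size_tpath u x v :
  btw u x v -> size (tpath u v) = (size (tpath u x) + size (tpath x v))%N.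
Proof. by move=> xuv; rewrite (tpath_cat xuv) size_cat. Qed.

Lemma tpath_size0 u v : size (tpath u v) = 0%N -> v = u.
Proof. by move=> /size0nil p0; rewrite -(last_tpath u v) p0. Qed.

(** Otherwise [m] lies between [z] and [v] while [z] lies between [m] and [v], and adding up path
    lengths forces [z = m]. *)
Lemma btw_trans u m z v : btw u m v -> btw m z v -> btw u m z.
Proof.
move=> muv zmv; have zuv : btw u z v by rewrite (btw_cat _ muv) zmv orbT.
have := muv; rewrite (btw_cat _ zuv) => /orP[//|mzv].
have := size_tpath zmv; rewrite (size_tpath mzv) => sz.
suff -> : z = m by rewrite btw_right.
by apply: tpath_size0; lia.
Qed.

(** The median is a vertex farthest from [u] among those common to the paths to [v] and to [w]:
    beyond it these paths share nothing, so they join into the path from [v] to [w]. *)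
Lemma ex_median u v w : exists m, [&& btw u m v, btw u m w & btw v m w].
Proof.
pose both := [pred z | btw u z v && btw u z w].
have bu : both u by rewrite /= !btw_left.
case: (arg_maxnP (fun z => size (tpath u z)) bu) => m /andP[muv muw] m_max.
exists m; rewrite muv muw /=.
suff cat_vmw : tpath v w = tpath v m ++ tpath m w.
  by rewrite /btw cat_vmw -cat_cons mem_cat -/(btw v m m) btw_right.
apply: tpath_catP => z; rewrite btw_sym => zmv zmw; apply: tpath_size0.
have mz := btw_trans muv zmv.
have := m_max z; rewrite /= (btw_cat _ muv) (btw_cat _ muw) zmv zmw !orbT.
rewrite (size_tpath mz) => /(_ isT); lia.
Qed.

End TreePaths.

(** * Ancestors, lowest common ancestors and balanced separators *)

Section RootedTree.
Local Open Scope nat_scope.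
Variables (V : finType) (e : rel V).
Hypothesis tree_e : is_tree e.
Variable r : V.

Notation tpath := (tpath tree_e).
Notation btw := (btw tree_e).

Definition anc a v := btw r a v.

Lemma anc_refl a : anc a a. Proof. exact: btw_right. Qed.

Lemma anc_trans b a c : anc a b -> anc b c -> anc a c.
Proof. by rewrite /anc => ab bc; rewrite (btw_cat _ bc) ab. Qed.

Lemma anc_total v a b : anc a v -> anc b v -> anc a b || anc b a.
Proof.
move=> av; rewrite /anc (btw_cat _ av) => /orP[->|/(btw_trans av)->//].
by rewrite orbT.
Qed.

Definition depth v := size (tpath r v).

Lemma anc_depth a b : anc a b -> depth b <= depth a -> a = b.
Proof.
move=> ab; rewrite /depth (size_tpath ab) => le_ba; symmetry.
by apply: (tpath_size0 (tree_e := tree_e)); lia.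
Qed.

Lemma anc_depth_le a b : anc a b -> depth a <= depth b.
Proof. by move=> ab; rewrite /depth (size_tpath ab) leq_addr. Qed.

Lemma anc_anti a b : anc a b -> anc b a -> a = b.
Proof. by move=> ab /anc_depth_le; exact: anc_depth. Qed.

Lemma anc_btw a b u : anc a b -> anc b u -> btw a b u.
Proof.
move=> ab bu; have := bu; rewrite {1}/anc (btw_cat _ (anc_trans ab bu)).
by case/orP=> // /(anc_anti ab) <-; rewrite btw_left.
Qed.

Definition lca u v := xchoose (ex_median tree_e r u v).

Lemma lcaP u v : [/\ anc (lca u v) u, anc (lca u v) v & btw u (lca u v) v].
Proof. exact/and3P/(xchooseP (ex_median tree_e r u v)). Qed.

(** A common ancestor not above the median would lie on both branches from the median to [u] and to
    [v], and these share only the median itself. *)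
Lemma anc_lca a u v : anc a u -> anc a v -> anc a (lca u v).
Proof.
case: (lcaP u v) => lu lv ulv au av.
move: (au) (av); rewrite {1 2}/anc (btw_cat _ lu) (btw_cat _ lv).
case/orP=> // lau /orP[//|lav].
by rewrite (btw_cat_inter ulv _ lav) ?anc_refl // btw_sym.
Qed.

Lemma lca_unique u v l :
  anc l u -> anc l v -> (forall a, anc a u -> anc a v -> anc a l) -> lca u v = l.
Proof.
move=> lu lv l_max; case: (lcaP u v) => lcau lcav _.
by apply: anc_anti; [apply: l_max | apply: anc_lca].
Qed.

Lemma lca_sym u v : lca u v = lca v u.
Proof.
by case: (lcaP v u) => lv lu _; apply: lca_unique => // a au av; exact: anc_lca.
Qed.

Lemma lca_anc u v : anc u v -> lca u v = u.
Proof. by move=> uv; apply: lca_unique => //; exact: anc_refl. Qed.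

Lemma lcaxx u : lca u u = u. Proof. exact/lca_anc/anc_refl. Qed.

(** [lca a b] and [lca a c] are ancestors of [a], hence comparable; the upper one is the result. *)
Lemma lca_lca a b c : lca (lca a b) c = lca a b \/ lca (lca a b) c = lca a c.
Proof.
have [[xa xb _] [ya yc _]] := (lcaP a b, lcaP a c).
case/orP: (anc_total xa ya) => [xy|yx].
  by left; apply: lca_anc; exact: anc_trans yc.
right; apply: lca_unique => // z zx zc; apply: anc_lca => //.
exact: anc_trans xa.
Qed.

Definition lca_closed (A : {set V}) := {in A &, forall u v, lca u v \in A}.

Definition lca_closure (A : {set V}) := [set lca p.1 p.2 | p in setX A A].

(** A single round of pairwise ancestors is enough: by [lca_lca] the common ancestor of four
    vertices is already that of two of them. *)
Lemma lca_closureP A : lca_closed (lca_closure A).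
Proof.
have mem a b : a \in A -> b \in A -> lca a b \in lca_closure A.
  by move=> aA bA; apply/imsetP; exists (a, b) => //; rewrite inE aA bA.
move=> _ _ /imsetP[[a b] /setXP[/= aA bA] ->] /imsetP[[c d] /setXP[/= cA dA] ->].
case: (lca_lca a b (lca c d)) => ->; first exact: mem.
by rewrite lca_sym; case: (lca_lca c d a) => ->; exact: mem.
Qed.

Lemma sub_lca_closure (A : {set V}) : A \subset lca_closure A.
Proof.
by apply/subsetP => a aA; apply/imsetP; exists (a, a); rewrite ?inE ?aA ?lcaxx.
Qed.

Lemma lca_closure_sub (A B : {set V}) : A \subset B -> lca_closed B -> lca_closure A \subset B.
Proof.
move=> /subsetP sAB clB; apply/subsetP => _ /imsetP[[a b] /setXP[/= aA bA] ->].
by apply: clB; exact: sAB.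
Qed.

Lemma card_lca_closure (A : {set V}) : #|lca_closure A| <= #|A| ^ 2.
Proof. by rewrite -mulnn -cardsX leq_imset_card. Qed.

Lemma lca_closed_top (C : {set V}) x :
  lca_closed C -> x \in C -> exists2 u, u \in C & forall y, y \in C -> anc u y.
Proof.
move=> clC xC; case: (arg_minnP depth xC) => u uC u_min; exists u => // y yC.
case: (lcaP u y) => lu ly _; rewrite -(anc_depth lu) //.
exact/u_min/clC.
Qed.

(** The case [x = y] is included, so [C] is also disjoint from [S]. *)
Definition separated (S C : {set V}) :=
  forall x s y, x \in C -> s \in S -> y \in C -> ~~ btw x s y.

(** Greedy choice: each chosen vertex removes from [A] a subtree with at least [t.+1] vertices of
    [A], which pays for it. *)
Lemma exists_separator t (A : {set V}) : lca_closed A ->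
  exists S : {set V}, [/\ S \subset A, #|S| * t.+1 <= #|A| &
    forall C : {set V}, C \subset A -> lca_closed C -> separated S C -> #|C| <= t].
Proof.
have [n] := ubnP #|A|; elim: n => // n IH in A *; rewrite ltnS => leAn clA.
have [leAt|ltA] := leqP #|A| t.
  exists set0; rewrite sub0set cards0; split=> // C sCA _ _.
  exact: leq_trans (subset_leq_card sCA) leAt.
have [x xA] : exists x, x \in A by apply/set0Pn; rewrite -card_gt0; lia.
have [u uA u_top] := lca_closed_top clA xA.
pose bel v := [set z in A | anc v z].
pose heavy := [pred v | (v \in A) && (t < #|bel v|)].
have hu : heavy u.
  rewrite /= uA (leq_trans ltA) // subset_leq_card //.
  by apply/subsetP => y yA; rewrite inE yA u_top.
(* [v] is a lowest heavy vertex: every branch hanging below it is light. *)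
case: (arg_maxnP depth hu) => v /andP[vA hv] v_low.
pose A' := A :\: bel v.
have sA'A : A' \subset A by apply: subsetDl.
have sbA : bel v \subset A by apply/subsetP => z; rewrite inE => /andP[].
have cardA : #|A| = #|bel v| + #|A'| by rewrite -(cardsID (bel v)) (setIidPr sbA).
have clA' : lca_closed A'.
  move=> a b; rewrite !inE => /andP[+ aA] /andP[_ bA]; rewrite aA (clA _ _ aA bA) andbT.
  apply: contra => vl; case: (lcaP a b) => la _ _; exact: anc_trans la.
have [S [sSA' cardS sepS]] := IH A' ltac:(lia) clA'.
exists (v |: S); split.
- by rewrite subUset sub1set vA (subset_trans sSA').
- by rewrite cardsU1; case: (v \notin S); lia.
move=> C sCA clC sepC.
(* If [C] reaches below [v], its top vertex [w] is strictly below [v] because [v] separates; hence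
   [w] is not heavy, and [C] lies under [w]. Otherwise [C] lies in [A']. *)
have [/exists_inP[x' x'C vx']|] := boolP [exists y in C, anc v y].
  have [w wC w_top] := lca_closed_top clC x'C.
  have nvC y z : y \in C -> z \in C -> ~~ btw y v z.
    by move=> yC zC; apply: sepC; rewrite ?setU11.
  have vw : anc v w.
    move: vx' (nvC _ _ wC x'C); rewrite /anc => vx'.
    by case/orP: (btw_triangle w vx') => // ->.
  have wA := subsetP sCA _ wC.
  have ltvw : depth v < depth w.
    rewrite ltnNge; apply/negP => /(anc_depth vw) evw.
    by have := nvC _ _ wC wC; rewrite evw btw_left.
  have : ~~ heavy w by apply: contraL ltvw => /v_low; rewrite -leqNgt.
  rewrite /= wA /= -leqNgt; apply: leq_trans; apply: subset_leq_card.
  by apply/subsetP => y yC; rewrite inE w_top // (subsetP sCA).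
rewrite negb_exists_in => /forall_inP nvC; apply: sepS => //.
  apply/subsetP => y yC; rewrite !inE negb_and (nvC y yC) orbT.
  exact: (subsetP sCA).
by move=> y s z yC sS zC; apply: sepC => //; rewrite !inE sS orbT.
Qed.

Lemma exists_lca_separator q t (A : {set V}) :
  0 < t -> #|A| <= q * t -> lca_closed A ->
  exists S : {set V}, [/\ S \subset A, lca_closed S, #|S| <= q.-1 ^ 2 &
    forall C : {set V}, C \subset A -> lca_closed C -> separated S C -> #|C| <= t].
Proof.
move=> t0 cardA clA; have [S [sSA cardS sepS]] := exists_separator t clA.
exists (lca_closure S); split.
- exact: lca_closure_sub.
- exact: lca_closureP.
- apply: leq_trans (card_lca_closure S) _; rewrite leq_sqr.
  (* For [q > 0] this leaves fewer than [q] chosen vertices; closing at most squares their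
     number. *)
  have : #|S| * t.+1 <= q * t by lia.
  case: q {cardA} => [|q]; first by nia.
  move=> /= h; rewrite leqNgt; apply/negP => /leq_mul/(_ (leqnn t.+1)); lia.
move=> C sCA clC sepC; apply: sepS => // x s y xC sS yC.
by apply: sepC => //; exact: (subsetP (sub_lca_closure S)).
Qed.

(** * Components of [A] outside [S] and their boundaries *)

Section Components.
Variables A S : {set V}.
Hypotheses (clA : lca_closed A) (clS : lca_closed S).

Definition component u := [set v in A | [forall s in S, ~~ btw u s v]].
(** The vertices of [S] met first on paths leaving [u]. For [u] in [S] this is [u] alone, and
    [component u] is empty. *)
Definition boundary u := [set s in S | [forall x in S, btw u x s ==> (x == s)]].

Lemma componentP u v :
  reflect (v \in A /\ forall s, s \in S -> ~~ btw u s v) (v \in component u).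
Proof. by rewrite inE; apply: (iffP andP) => -[vA /forall_inP]. Qed.

Lemma boundaryP u s :
  reflect (s \in S /\ forall x, x \in S -> btw u x s -> x = s) (s \in boundary u).
Proof.
rewrite inE; apply: (iffP andP) => -[sS].
  by move=> /forall_inP b; split=> // x /b/implyP h /h/eqP.
by move=> b; split=> //; apply/forall_inP => x xS; apply/implyP => /(b _ xS)/eqP.
Qed.

Lemma component_sub u : component u \subset A.
Proof. by apply/subsetP => v /componentP[]. Qed.

Lemma component_notin u v : v \in component u -> v \notin S.
Proof. by case/componentP=> _ h; apply/negP => /h; rewrite btw_right. Qed.

Lemma component_refl u : u \in A -> u \notin S -> u \in component u.
Proof.
move=> uA uS; apply/componentP; split=> // s sS; rewrite btw_same.
by apply: contraNneq uS => <-.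
Qed.

Lemma component_eq u v : v \in component u -> component v = component u.
Proof.
case/componentP=> vA sep; apply/setP => w.
by apply/componentP/componentP => -[wA sepw]; split=> // s sS;
  apply/negP => h; have := sep s sS; have := sepw s sS;
  [case/orP: (btw_triangle v h) => -> | case/orP: (btw_triangle u h)]
  => //; rewrite btw_sym => ->.
Qed.

Lemma boundary_eq u v : v \in component u -> boundary v = boundary u.
Proof.
case/componentP=> vA sep; apply/setP => w.
apply/boundaryP/boundaryP => -[wS bw]; split=> // x xS h; apply: bw => //.
  by case/orP: (btw_triangle v h) => //; rewrite (negPf (sep x xS)).
case/orP: (btw_triangle u h) => //.
by rewrite btw_sym (negPf (sep x xS)).
Qed.

Lemma component_separated u : separated S (component u).
Proof.
move=> x s y /component_eq ex sS; rewrite -ex => /componentP[_]; exact.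
Qed.

Lemma component_closed u : lca_closed (component u).
Proof.
move=> x y xC yC; have [_ _ l] := lcaP x y.
have xA := subsetP (component_sub u) _ xC; have yA := subsetP (component_sub u) _ yC.
rewrite -(component_eq xC); apply/componentP; split; first exact: clA.
move=> s sS; apply/negP => xsl.
have := component_separated xC sS yC; by rewrite (btw_cat _ l) xsl.
Qed.

(** A vertex between [s] and [s'] lies between [u] and one of them, where only that one is in
    [S]. *)
Lemma boundary_adjacent u s s' : s \in boundary u -> s' \in boundary u ->
  forall x, x \in S -> btw s x s' -> x = s \/ x = s'.
Proof.
case/boundaryP=> sS bs /boundaryP[s'S bs'] x xS /(btw_triangle u).
by rewrite btw_sym => /orP[/(bs _ xS)|/(bs' _ xS)]; [left|right].
Qed.

(* At most one boundary vertex lies above the component and at most one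
   below it. *)
Lemma card_boundary u : #|boundary u| <= 2.
Proof.
pose U := [set s | anc s u]; have inU s : (s \in U) = anc s u by rewrite inE.
rewrite -(cardsID U) (_ : 2 = 1 + 1) //.
apply: leq_add; apply/card_le1_eqP => s s'; rewrite !(in_setI, in_setD) !inU.
  move=> /andP[/boundaryP[sS bs] su] /andP[/boundaryP[s'S bs'] s'u].
  case/orP: (anc_total su s'u) => [ss'|s's]; [apply: bs|symmetry; apply: bs'] => //;
    by rewrite btw_sym anc_btw.
move=> /andP[nsu sB] /andP[ns'u s'B].
have below x y : ~~ anc x u -> y \in boundary u -> x \in S -> anc x y -> x = y.
  move=> nxu /boundaryP[yS bdy] xS xy; apply: bdy => //.
  by have := btw_triangle u xy; rewrite -/(anc x u) (negPf nxu).
have [[sS _] [s'S _]] := (boundaryP _ _ sB, boundaryP _ _ s'B).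
(* The common ancestor of two lower boundary vertices is in [S] and between them, so it is one of
   them; being above the other, it equals it by [below]. *)
have [ls ls' l] := lcaP s s'.
case: (boundary_adjacent sB s'B (clS sS s'S) l) => el; [symmetry|]; apply: below => //.
  by rewrite -el.
by rewrite -el.
Qed.
End Components.
End RootedTree.

(** * Chordal shortcuts built from separators *)

Section Shortcuts.
Local Open Scope nat_scope.
Variables (V : finType) (e : rel V).
Hypothesis tree_e : is_tree e.
Variable r : V.

Notation tpath := (tpath tree_e).
Notation btw := (btw tree_e).
Notation lca_closed := (lca_closed tree_e r).
Notation component := (component tree_e).
Notation boundary := (boundary tree_e).

Definition up_adj (up : V -> {set V}) (A : {set V}) : rel V :=
  fun x y => [&& x \in A, y \in A & (x \in up y) || (y \in up x)].

(* A chordal graph on [A], given by a perfect elimination ordering: [up v] is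
   the clique of those neighbours of [v] which have smaller rank. *)
Record shortcut_data (A : {set V}) (k w : nat) (up : V -> {set V})
    (rk : V -> nat) : Prop := ShortcutData {
  up_sub : forall v, v \in A -> up v \subset A;
  up_card : forall v, v \in A -> #|up v| <= w;
  up_rank : forall u v, v \in A -> u \in up v -> rk u < rk v;
  up_clique : forall v x y, v \in A -> x \in up v -> y \in up v ->
    x = y \/ up_adj up A x y;
  up_tree : forall u v, u \in A -> v \in A -> u != v ->
    (forall x, x \in A -> btw u x v -> x = u \/ x = v) -> up_adj up A u v;
  up_hops : forall u v, u \in A -> v \in A ->
    exists p, [/\ path (up_adj up A) u p, last u p = v, size p <= k
                & subseq p (tpath u v)] }.

(** Quantifying over closed sets rather than whole trees lets the recursion apply to separators and
    to components alike. *)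
Definition shortcuttable k w N := forall A : {set V}, lca_closed A ->
  #|A| <= N -> exists up rk, shortcut_data A k w up rk.

Lemma up_adj_sym up A : symmetric (up_adj up A).
Proof. by move=> x y; rewrite /up_adj orbC; case: (x \in A); case: (y \in A). Qed.

Lemma hop_path (f : rel V) x y : x = y \/ f x y ->
  exists p, [/\ path f x p, last x p = y, size p <= 1 & subseq p (tpath x y)].
Proof.
have [<- _|nxy [/eqP|fxy]] := eqVneq x y; last 2 first.
- by rewrite (negPf nxy).
- by exists [:: y]; rewrite /= fxy sub1seq mem_tpath.
by exists [::]; rewrite sub0seq.
Qed.

Lemma hop_cat (f : rel V) x y z p q : btw x y z ->
  path f x p -> last x p = y -> subseq p (tpath x y) ->
  path f y q -> last y q = z -> subseq q (tpath y z) ->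
  [/\ path f x (p ++ q), last x (p ++ q) = z & subseq (p ++ q) (tpath x z)].
Proof.
move=> xyz fp lp sp fq lq sq.
by rewrite cat_path last_cat lp fp fq lq (tpath_cat xyz) cat_subseq.
Qed.

Lemma shortcut_data1 (A : {set V}) k w :
  #|A| <= 1 -> shortcut_data A k w (fun=> set0) (fun=> 0).
Proof.
move/card_le1_eqP => A1; split=> [v _|v _|u v _|v x y _|u v uA vA|u v uA vA].
- exact: sub0set.
- by rewrite cards0.
- by rewrite inE.
- by rewrite inE.
- by rewrite (A1 v u) ?eqxx.
- by exists [::]; rewrite (A1 v u vA uA) sub0seq.
Qed.

Lemma shortcuttable0 : shortcuttable 0 0 1.
Proof. by move=> A _ A1; do 2 eexists; apply: shortcut_data1. Qed.

Lemma shortcuttable1 N : shortcuttable 1 N N.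
Proof.
move=> A _ cardA.
exists (fun v => [set u in A | enum_rank u < enum_rank v]), (fun v => enum_rank v : nat).
have adj x y : x \in A -> y \in A -> x = y \/
    up_adj (fun v => [set u in A | enum_rank u < enum_rank v]) A x y.
  move=> xA yA; have [->|nxy] := eqVneq x y; [by left | right].
  by rewrite /up_adj !inE xA yA /= -neq_ltn; apply: contra nxy => /eqP/val_inj/enum_rank_inj ->.
split=> [v _|v _|u v _|v x y _|u v uA vA nuv _|u v uA vA].
- by apply/subsetP => u; rewrite inE => /andP[].
- by apply: leq_trans cardA; apply/subset_leq_card/subsetP => u; rewrite inE => /andP[].
- by rewrite inE => /andP[].
- by rewrite !inE => /andP[xA _] /andP[yA _]; exact: adj.
- by case: (adj u v uA vA) => // /eqP; rewrite (negPf nuv).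
- by case: (hop_path (adj u v uA vA)) => p [? ? ? ?]; exists p.
Qed.

Lemma exists_gate (S : {set V}) u s : s \in S ->
  exists2 s', s' \in S & btw u s' s /\ s' \in boundary S u.
Proof.
move=> sS; pose P := [pred x | (x \in S) && btw u x s].
have Ps : P s by rewrite /= sS btw_right.
case: (arg_minnP (fun x => size (tpath u x)) Ps) => s' /andP[s'S us's] s'_min.
exists s' => //; split=> //; apply/boundaryP; split=> // x xS uxs'.
have := s'_min x; rewrite /= xS (btw_cat _ us's) uxs' => /(_ isT).
rewrite (size_tpath uxs') => le; symmetry.
by apply: (tpath_size0 (tree_e := tree_e)); lia.
Qed.

(** The graph on [S] is kept; each component adds its own graph and edges to its at most two
    boundary vertices, which accounts for [w'.+2]. A path crossing [S] spends at most one hop at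
    each end and [k] hops inside [S]. *)
Lemma shortcut_data_glue (A S : {set V}) k w w' upS rkS :
  lca_closed A -> lca_closed S -> S \subset A ->
  shortcut_data S k w upS rkS ->
  (forall u, u \in A -> u \notin S ->
     exists up rk, shortcut_data (component A S u) k.+2 w' up rk) ->
  exists up rk, shortcut_data A k.+2 (maxn w w'.+2) up rk.
Proof.
move=> clA clS /subsetP sSA dataS dataC.
(* The data are chosen per component as a set, so that all vertices of one component share them. *)
have [F F_data] : exists F : {set V} -> (V -> {set V}) * (V -> nat),
    forall u, u \in A -> u \notin S ->
      shortcut_data (component A S u) k.+2 w' (F (component A S u)).1
        (F (component A S u)).2.
  have [|F HF] := @boolp.choice {set V} ((V -> {set V}) * (V -> nat)) (fun C d =>
    (exists u, [/\ u \in A, u \notin S & C = component A S u]) ->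
    shortcut_data C k.+2 w' d.1 d.2).
    move=> C; case: (boolp.pselect (exists u, [/\ u \in A, u \notin S & C = component A S u])).
      by case=> u [uA uS ->]; have [up [rk d]] := dataC u uA uS; exists (up, rk).
    by move=> nex; exists (fun=> set0, fun=> 0).
  by exists F => u uA uS; apply: HF; exists u.
pose C u := component A S u.
pose up v := if v \in S then upS v else (F (C v)).1 v :|: boundary S v.
(* The offset ranks every vertex outside [S] above all of [S]. *)
pose rk v := if v \in S then rkS v else (\max_(s in S) rkS s).+1 + (F (C v)).2 v.
exists up, rk.
have sCA u x : x \in C u -> x \in A by apply/subsetP/component_sub.
have nCS u x : x \in C u -> x \notin S by exact: component_notin.
have inC u : u \in A -> u \notin S -> u \in C u by exact: component_refl.
have eqC u x : x \in C u -> C x = C u by exact: component_eq.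
have bC u x : x \in C u -> boundary S x = boundary S u by exact: boundary_eq.
have sbS u x : x \in boundary S u -> x \in S by case/boundaryP.
have adjS x y : up_adj upS S x y -> up_adj up A x y.
  by case/and3P=> xS yS; rewrite /up_adj /up xS yS !sSA.
have adjC u x y : up_adj (F (C u)).1 (C u) x y -> up_adj up A x y.
  case/and3P=> xC yC; rewrite /up_adj /up (negPf (nCS _ _ xC)) (negPf (nCS _ _ yC)).
  rewrite (eqC _ _ xC) (eqC _ _ yC) (sCA _ _ xC) (sCA _ _ yC) /= !in_setU.
  by case/orP=> ->; rewrite ?orbT.
have adjb u s : u \in A -> u \notin S -> s \in boundary S u -> up_adj up A u s.
  move=> uA uS sb; rewrite /up_adj uA sSA ?(sbS u) //= /up (negPf uS) in_setU sb.
  by rewrite !orbT.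
have data u : u \in A -> u \notin S -> shortcut_data (C u) k.+2 w' (F (C u)).1 (F (C u)).2.
  exact: F_data.
split.
- move=> v vA; rewrite /up; case: ifPn => vS.
    exact: subset_trans (up_sub dataS vS) (introT subsetP sSA).
  apply/subsetP => x; rewrite in_setU => /orP[xC|/sbS /sSA//].
  by apply/(sCA v)/(subsetP (up_sub (data v vA vS) (inC v vA vS))).
- move=> v vA; rewrite /up leq_max; case: ifPn => vS.
    by rewrite (up_card dataS vS).
  apply/orP; right; rewrite -addn2; apply: leq_trans (leq_card_setU _ _) _.
  apply: leq_add; last exact: card_boundary clS _.
  exact: (up_card (data v vA vS) (inC v vA vS)).
- move=> u v vA; rewrite /up; case: ifPn => vS.
    move=> uv; rewrite /rk vS (subsetP (up_sub dataS vS) _ uv).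
    exact: (up_rank dataS vS uv).
  have vC := inC v vA vS; rewrite in_setU /rk (negPf vS) => /orP[uv|/sbS uS].
    have uC := subsetP (up_sub (data v vA vS) vC) _ uv.
    rewrite (negPf (nCS _ _ uC)) (eqC _ _ uC) ltn_add2l.
    exact: (up_rank (data v vA vS) vC uv).
  by rewrite uS ltnS; apply: leq_trans (leq_addr _ _); exact: leq_bigmax_cond.
- move=> v x y vA; rewrite {1 2}/up; case: ifPn => vS.
    by move=> xv yv; case: (up_clique dataS vS xv yv) => [|/adjS]; [left|right].
  have vC := inC v vA vS; have dv := data v vA vS; rewrite !in_setU.
  have mixed x' y' : x' \in (F (C v)).1 v -> y' \in boundary S v -> up_adj up A x' y'.
    move=> x'v y'b; have x'C := subsetP (up_sub dv vC) _ x'v.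
    by apply: adjb; [exact: sCA x'C | exact: nCS x'C | rewrite (bC _ _ x'C)].
  case/orP=> xv /orP[] yv.
  + by case: (up_clique dv vC xv yv) => [|/adjC]; [left|right].
  + right; exact: (mixed x y xv yv).
  + by right; rewrite up_adj_sym; exact: (mixed y x yv xv).
  (* This is what [up_tree] is for: two boundary vertices are neighbours in [S], hence adjacent. *)
  + have [->|nxy] := eqVneq x y; [by left | right; apply: adjS].
    apply: (up_tree dataS) => //; [exact: sbS xv | exact: sbS yv |].
    exact: (boundary_adjacent xv yv).
- have half u v : u \in A -> u \notin S -> v \in S ->
      (forall x, x \in A -> btw u x v -> x = u \/ x = v) -> up_adj up A u v.
    move=> uA uS vS uv; apply: adjb => //; apply/boundaryP; split=> // x xS.
    by case/(uv x (sSA x xS)) => // exu; rewrite exu (negPf uS) in xS.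
  move=> u v uA vA nuv uv.
  have [uS|uS] := boolP (u \in S); have [vS|vS] := boolP (v \in S).
  + by apply/adjS/(up_tree dataS) => // x /sSA; exact: uv.
  + by rewrite up_adj_sym; apply: half => // x xA; rewrite btw_sym => /(uv x xA)[]; [right|left].
  + exact: half.
  + apply: (@adjC u); apply: (up_tree (data u uA uS)) => //; first exact: inC.
      apply/componentP; split=> // s sS; apply/negP.
      by case/(uv s (sSA s sS)) => es; rewrite -es sS in uS vS.
    by move=> x /sCA; exact: uv.
- move=> u v uA vA.
  (* Either the path avoids [S] and stays in one component, or it is routed through the gates [s1]
     of [u] and [s2] of [v], met in the order [u], [s1], [s2], [v]. A gate may coincide with an
     end. *)
  have [/exists_inP[s sS usv]|nS] := boolP [exists s in S, btw u s v]; last first.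
    have nS' s : s \in S -> ~~ btw u s v.
      by move: nS; rewrite negb_exists_in => /forall_inP; exact.
    have uS : u \notin S by apply/negP => /nS'; rewrite btw_left.
    have vC : v \in C u by apply/componentP.
    have [p [fp lp sp up_p]] := up_hops (data u uA uS) (inC u uA uS) vC.
    exists p; split=> //; apply: sub_path fp => x y; exact: adjC.
  have link x t : x \in A -> t \in boundary S x -> x = t \/ up_adj up A x t.
    move=> xA tb; have [xS|xS] := boolP (x \in S); last by right; exact: adjb.
    by left; case/boundaryP: tb => _; apply=> //; exact: btw_left.
  have [s1 s1S [us1s s1b]] := exists_gate u sS.
  have us1v : btw u s1 v by rewrite (btw_cat _ usv) us1s.
  have [s2 s2S [vs2s1 s2b]] := exists_gate v s1S.
  have s1s2v : btw s1 s2 v by rewrite btw_sym.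
  have [p1 [f1 l1 sz1 sub1]] := hop_path (link u s1 uA s1b).
  have [p2 [f2 l2 sz2 sub2]] := up_hops dataS s1S s2S.
  have {}f2 : path (up_adj up A) s1 p2 by apply: sub_path f2 => x y; exact: adjS.
  have link2 : s2 = v \/ up_adj up A s2 v.
    by rewrite up_adj_sym; case: (link v s2 vA s2b); [left|right].
  have [p3 [f3 l3 sz3 sub3]] := hop_path link2.
  have [f23 l23 sub23] := hop_cat s1s2v f2 l2 sub2 f3 l3 sub3.
  have [f l sub] := hop_cat us1v f1 l1 sub1 f23 l23 sub23.
  exists (p1 ++ p2 ++ p3); split=> //.
  by rewrite !size_cat -[k.+2]add1n -[k.+1]addn1 !leq_add.
Qed.

(** A set of size [q ^ j.+1] has a closed separator of at most [q.-1 ^ 2] vertices that leaves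
    components of size at most [q ^ j]. Each level costs two units of width, but the hop bound does
    not grow: a pair is routed at the first level whose separator meets its path. *)
Lemma shortcuttable_step k w N q j : 0 < q -> q.-1 ^ 2 <= N ->
  shortcuttable k w N -> shortcuttable k.+2 (w + j.*2) (q ^ j).
Proof.
move=> q0 qN scN; elim: j => [|j IH] A clA cardA.
  by do 2 eexists; apply: shortcut_data1.
have [|||S [sSA clS cardS sepS]] := @exists_lca_separator V e tree_e r q (q ^ j) A.
- by rewrite expn_gt0 q0.
- by rewrite -expnS.
- by [].
have [upS [rkS dataS]] := scN S clS (leq_trans cardS qN).
have -> : w + j.+1.*2 = maxn w (w + j.*2).+2 by lia.
apply: shortcut_data_glue dataS _ => // u uA uS.
have clC : lca_closed (component A S u) by exact: component_closed.
apply: IH => //; apply: sepS => //; first exact: component_sub.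
exact: component_separated.
Qed.

(** Taking [q = b ^ (l ^ m)] makes [q ^ 2] the size reached so far, and [l.*2] levels extend it to
    [b ^ (l ^ m.+1).*2]. *)
Lemma shortcuttable_iter k w b l m : 0 < b ->
  shortcuttable k w (b ^ 2) ->
  shortcuttable (k + m.*2) (w + m * l.*2.*2) (b ^ (l ^ m).*2).
Proof.
move=> b0 base; elim: m => [|m IH]; first by rewrite mul0n !addn0.
have q0 : 0 < b ^ (l ^ m) by rewrite expn_gt0 b0.
have := @shortcuttable_step _ _ _ (b ^ (l ^ m)) l.*2 q0 _ IH.
rewrite -expnM (_ : l ^ m * l.*2 = (l ^ m.+1).*2); last by rewrite expnS; lia.
rewrite (_ : (k + m.*2).+2 = k + m.+1.*2); last lia.
rewrite (_ : w + m * _ + _ = w + m.+1 * l.*2.*2); last lia.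
apply; rewrite -muln2 expnM leq_exp2r //; lia.
Qed.

End Shortcuts.

(** * From elimination orderings to tree decompositions *)

Section Treewidth.
Local Open Scope nat_scope.
Variable V : finType.

(** The inequality drops the loop at the root, which is its own parent. *)
Definition parent_rel (par : V -> V) : rel V :=
  fun a b => (a != b) && ((a == par b) || (b == par a)).

Lemma parent_rel_sym par : symmetric (parent_rel par).
Proof. by move=> a b; rewrite /parent_rel eq_sym orbC. Qed.

Lemma parent_tree (par : V -> V) (h : V -> nat) root :
  par root = root -> (forall v, v != root -> h (par v) < h v) ->
  is_tree (parent_rel par).
Proof.
move=> par_root h_par.
have t_sym := parent_rel_sym par.
have to_root v : connect (parent_rel par) v root.
  have [n] := ubnP (h v); elim: n => // n IH in v *; rewrite ltnS => hv.
  have [->|nv] := eqVneq v root; first exact: connect0.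
  have lt_h := h_par v nv.
  apply: connect_trans (IH (par v) _); last by lia.
  apply: connect1; rewrite /parent_rel eqxx orbT andbT.
  by apply: contraTneq lt_h => <-; rewrite ltnn.
split.
- by split=> // v; rewrite /parent_rel eqxx.
- by apply/card_gt0P; exists root.
- move=> x y; apply: connect_trans (to_root x) _.
  by rewrite sym_connect_sym.
(* The highest vertex of a cycle would have two distinct parents. *)
move=> c; case: c => [//|x0 c0]; move: (x0 :: c0) (mem_head x0 c0) => c x0c size_c.
case/andP=> cyc uniq_c.
case: (arg_maxnP h x0c) => m mc m_max.
have up_m a : a \in c -> parent_rel par m a -> a = par m.
  move=> ac /andP[nma /orP[/eqP em|/eqP//]].
  have [ea|na] := eqVneq a root.
    by rewrite em ea par_root eqxx in nma.
  by have := h_par a na; have := m_max a ac; rewrite -em; lia.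
have [i c' def_c] := rot_to mc.
move: cyc uniq_c; rewrite -(rot_cycle i) -(rot_uniq i) def_c.
have in_c a : a \in c' -> a \in c.
  by move=> ac; rewrite -(mem_rot i) def_c inE ac orbT.
have : 2 < size (m :: c') by rewrite -def_c size_rot.
case: c' {def_c} in_c => [//|a c'] in_c size_c' /=.
rewrite rcons_path => /and3P[ma _ bm] /and3P[_ aNc' _].
rewrite parent_rel_sym in bm.
have c'_last : last a c' \in c'.
  by case: c' size_c' {in_c bm aNc'} => //= b c' _; exact: mem_last.
have ea := up_m a (in_c _ (mem_head _ _)) ma.
have eb := up_m (last a c') (in_c _ (mem_last _ _)) bm.
by move: aNc'; rewrite ea -{1}eb c'_last.
Qed.

(** The decomposition tree lives on the vertices themselves, with bags [v |: up v]; the parent of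
    [v] is a vertex of highest rank in [up v], or the root if [up v] is empty. *)
Lemma elimination_treewidth (g : rel V) (up : V -> {set V}) (rk : V -> nat) w :
  0 < #|V| ->
  (forall u v, g u v -> (u \in up v) || (v \in up u)) ->
  (forall u v, u \in up v -> rk u < rk v) ->
  (forall v x y, x \in up v -> y \in up v -> [|| x == y, x \in up y | y \in up x]) ->
  (forall v, #|up v| <= w) ->
  treewidth g <= w.
Proof.
case/card_gt0P=> x0 x0V g_up up_lt up_cl up_w.
case: (arg_minnP rk x0V) => root _ root_min.
have up_root : up root = set0.
  apply/setP => x; rewrite inE; apply/negP => /up_lt; rewrite ltnNge.
  by rewrite root_min.
have [par par_up par_max] : exists2 par : V -> V,
    forall v, up v != set0 -> par v \in up v /\ (forall x, x \in up v -> rk x <= rk (par v))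
    & forall v, up v = set0 -> par v = root.
  exists (fun v => if [pick x in up v] is Some x then [arg max_(y > x in up v) rk y] else root).
    move=> v; case: pickP => [x xv _|up0 /set0Pn[x]]; last by rewrite up0.
    by case: arg_maxnP => // y yv y_max; split.
  by move=> v v0; case: pickP => // x; rewrite v0 inE.
(* A vertex with empty [up] hangs from [root] but may have the same rank; the shift keeps [h]
   strictly decreasing towards the root. *)
pose h v := if v == root then 0 else (rk v).+1.
have t_tree : is_tree (parent_rel par).
  apply: (@parent_tree par h root); first exact: par_max.
  move=> v nv; rewrite /h (negPf nv); case: ifP => // np.
  have [v0|/par_up[/up_lt //]] := eqVneq (up v) set0.
  by rewrite par_max ?eqxx in np.
pose B v := v |: up v.
have decB : tree_decomposition g (parent_rel par) B.
  split=> //.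
  - by move=> v; exists v; rewrite setU11.
  - by move=> u v /g_up/orP[uv|vu]; [exists v | exists u]; rewrite setU11 !inE ?uv ?vu ?orbT.
  move=> v; set f := (fun a b => _).
  have f_sym : connect_sym f.
    apply: sym_connect_sym => a b; rewrite /f /= parent_rel_sym; congr (_ && _).
    exact: andbC.
  (* Moving to parents keeps [v] in the bag until [v] is reached: [v] and the parent of [i] both lie
     in the clique [up i], where the parent has the highest rank. *)
  suff to_v i : v \in B i -> connect f i v.
    by move=> i j vi vj; apply: connect_trans (to_v i vi) _; rewrite f_sym to_v.
  have [n] := ubnP (rk i); elim: n => // n IH in i *; rewrite ltnS => le_n.
  have [->|niv vi] := eqVneq i v; first by move=> _; exact: connect0.
  have vup : v \in up i by move: vi; rewrite !inE eq_sym (negPf niv).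
  have [|pi pi_max] := par_up i; first by apply/set0Pn; exists v.
  have vp : v \in B (par i).
    rewrite !inE; case/or3P: (up_cl i v (par i) vup pi) => [->//|->|/up_lt]; first by rewrite orbT.
    by rewrite ltnNge pi_max.
  have lt_p := up_lt _ _ pi.
  apply: connect_trans (IH (par i) _ vp); last by lia.
  apply: connect1; rewrite /f /= vi vp /parent_rel eqxx orbT !andbT.
  by apply: contraTneq lt_p => <-; rewrite ltnn.
rewrite /treewidth; case: ex_minnP => tw _ /(_ (decomposition_width B)) tw_min.
apply: leq_trans (tw_min _) _.
  by apply/boolp.asboolP; exists V, (parent_rel par), B.
rewrite /decomposition_width.
have : \max_i #|B i| <= w.+1; last by lia.
by apply/bigmax_leqP => v _; rewrite /B cardsU1 -add1n leq_add ?leq_b1.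
Qed.
End Treewidth.

From mathcomp Require Import all_classical all_reals all_analysis.
From mathcomp Require Import lra.
Local Open Scope ring_scope.

(** * Shortcut lengths and tree distances *)

Section Distances.
Variables (R : realType) (V : finType) (e : rel V) (wt : V -> V -> R).
Hypothesis tree_e : is_tree e.

Notation tpath := (tpath tree_e).

Lemma path_length_cat x p q :
  path_length wt x (p ++ q) = path_length wt x p + path_length wt (last x p) q.
Proof.
elim: p x => [|a p IH] x /=; first by rewrite /path_length big_nil add0r.
by rewrite /path_length /= !big_cons -!/(path_length _ _ _) IH addrA.
Qed.

Lemma graph_dist_tpath x y : graph_dist e wt x y = path_length wt x (tpath x y).
Proof.
rewrite /graph_dist (_ : [set p | _]%classic = [set tpath x y]%classic); last first.
  apply/seteqP; split=> p /=; first by move=> /tpath_eq <-.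
  by move=> ->; exact: tpathP.
by rewrite image_set1 inf1.
Qed.

Lemma graph_dist_btw u x v : btw tree_e u x v ->
  graph_dist e wt u v = graph_dist e wt u x + graph_dist e wt x v.
Proof. by move=> uxv; rewrite !graph_dist_tpath (tpath_cat uxv) path_length_cat last_tpath. Qed.

Lemma subseq_cons_cat (T : eqType) (x : T) p q s :
  x \notin q -> subseq (x :: p) (q ++ x :: s) = subseq p s.
Proof.
elim: q => [|y q IH]; first by rewrite /= eqxx.
by rewrite inE negb_or => /andP[nxy /IH <-]; rewrite /= (negPf nxy).
Qed.

(** Distances add up along a tree path, so skipping some of its vertices does not change the
    length. *)
Lemma path_length_subseq u v p : subseq p (tpath u v) -> last u p = v ->
  path_length (graph_dist e wt) u p = graph_dist e wt u v.
Proof.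
elim: p u => [|x p IH] u /=.
  by move=> _ <-; rewrite graph_dist_tpath tpathxx /path_length !big_nil.
move=> sub lp; rewrite /path_length /= big_cons -/(path_length _ _ _) /=.
have xuv : x \in tpath u v by apply: (mem_subseq sub); exact: mem_head.
have uxv : btw tree_e u x v by rewrite /btw inE xuv orbT.
rewrite (graph_dist_btw uxv) IH //.
move: sub xuv (uniq_tpath tree_e u v) (last_tpath tree_e u x); rewrite (tpath_cat uxv).
case/lastP: (tpath u x) => [|q y] sub xuv uniq_q.
  by move=> /= eux; move: uniq_q; rewrite /= {1}eux xuv.
rewrite last_rcons => eyx; move: sub uniq_q; rewrite eyx cat_rcons => sub.
rewrite cons_uniq cat_uniq => /and3P[_ _ /andP[/hasPn N _]].
by move: sub; rewrite subseq_cons_cat //; apply: N; exact: mem_head.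
Qed.

Lemma shortcut_data_shortcutting k w up rk :
  shortcut_data tree_e [set: V] k w up rk ->
  shortcutting e wt k (up_adj up [set: V]) /\
  (treewidth (up_adj up [set: V]) <= w)%N.
Proof.
move=> d; split.
  split; first split.
  - exact: up_adj_sym.
  - move=> v; rewrite /up_adj !inE orbb; apply/negP => /(up_rank d (finset.in_setT v)).
    by rewrite ltnn.
  move=> u v; have [p [fp lp sz sub]] := up_hops d (finset.in_setT u) (finset.in_setT v).
  exists p; split=> //; last exact: path_length_subseq.
  rewrite /simple_path fp lp eqxx.
  by apply: subseq_uniq (uniq_tpath tree_e u v); rewrite /= eqxx.
apply: (@elimination_treewidth _ _ up rk).
- by case: tree_e.
- by move=> u v; rewrite /up_adj !inE.
- by move=> u v; exact: (up_rank d (finset.in_setT v)).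
- move=> v x y xv yv; case: (up_clique d (finset.in_setT v) xv yv) => [->|].
    by rewrite eqxx.
  by case/and3P=> _ _ ->; rewrite orbT.
- by move=> v; exact: (up_card d (finset.in_setT v)).
Qed.

Lemma shortcuttable_shortcutting (r : V) k w N :
  shortcuttable tree_e r k w N -> (#|V| <= N)%N ->
  exists g, shortcutting e wt k g /\ (treewidth g <= w)%N.
Proof.
move=> sc leVN.
have clV : lca_closed tree_e r [set: V] by move=> u v _ _; exact: finset.in_setT.
have cardV : (#|[set: V]| <= N)%N by rewrite finset.cardsT.
have [up [rk d]] := sc _ clV cardV.
exists (up_adj up [set: V]); exact: shortcut_data_shortcutting d.
Qed.

End Distances.

(** * Logarithm estimates and the choice of parameters *)

Section Log2.
Variable R : realType.
Implicit Types x y : R.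

(** The bound [ln (1 + x) <= x] at [x = - (1 / 2)]. *)
Lemma ln2_ge_half : 1 / 2 <= ln (2 : R).
Proof.
have := @le_ln1Dx R (- (1 / 2)); rewrite (_ : 1 - 1 / 2 = 2^-1); last by lra.
by rewrite lnV ?posrE //; lra.
Qed.

Let ln2_gt0 : 0 < ln (2 : R). Proof. by have := ln2_ge_half; lra. Qed.

Lemma log2_2 : log2 (2 : R) = 1.
Proof. by rewrite /log2 divff // gt_eqF. Qed.

Lemma log2M x y : 0 < x -> 0 < y -> log2 (x * y) = log2 x + log2 y.
Proof. by move=> x0 y0; rewrite /log2 lnM ?posrE // mulrDl. Qed.

Lemma log2_div x y : 0 < x -> 0 < y -> log2 (x / y) = log2 x - log2 y.
Proof. by move=> x0 y0; rewrite /log2 ln_div ?posrE // mulrBl. Qed.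

Lemma log2X n x : 0 < x -> log2 (x ^+ n) = n%:R * log2 x.
Proof. by move=> x0; rewrite /log2 lnXn // mulr_natl mulrnAl. Qed.

Lemma ler_log2 x y : 0 < x -> 0 < y -> (log2 x <= log2 y) = (x <= y).
Proof. by move=> x0 y0; rewrite /log2 ler_pM2r ?invr_gt0 // ler_ln ?posrE. Qed.

Lemma log2_ge0 x : 1 <= x -> 0 <= log2 x.
Proof. by move=> x1; rewrite divr_ge0 ?(ltW ln2_gt0) ?ln_ge0. Qed.

(** The tangent to [ln] at 4; in [loglog_bound] the additive 2 is cancelled by [log2 4]. *)
Lemma log2_le_half x : 0 < x -> log2 x <= x / 2 + 2.
Proof.
move=> x0; have l2 := ln2_ge_half; rewrite /log2 ler_pdivrMr //.
have ln4 : ln (4 : R) = 2 * ln 2.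
  by rewrite (_ : 4 = 2 ^+ 2) ?lnXn ?mulr_natl // -natrX.
have := @le_ln1Dx R (x / 4 - 1) ltac:(lra).
by rewrite addrCA subrr addr0 ln_div ?posrE // ln4; nra.
Qed.

Lemma log2_le_id x : 1 <= x -> log2 x <= x.
Proof.
move=> x1; have l2 := ln2_ge_half; rewrite /log2 ler_pdivrMr //.
have := @le_ln1Dx R (x / 2 - 1) ltac:(lra).
by rewrite addrCA subrr addr0 ln_div ?posrE //; [nra | lra].
Qed.

Lemma leq_log2_exp n b K : (0 < n)%N -> (0 < b)%N ->
  log2 (n%:R : R) <= K%:R * log2 b%:R -> (n <= b ^ K)%N.
Proof.
move=> n0 b0; rewrite -log2X ?ltr0n // ler_log2 ?exprn_gt0 ?ltr0n //.
by rewrite -natrX ler_nat.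
Qed.

Lemma nat_approx x : 0 <= x -> exists2 n : nat, x <= n%:R & n%:R <= x + 1.
Proof.
move=> /truncn_itv/andP[le_x lt_x]; exists (Num.truncn x).+1; first exact: ltW.
by rewrite -natr1 lerD2r.
Qed.

Lemma root_powR x m : (0 < m)%N -> 1 <= x ->
  1 <= x `^ (m%:R^-1) /\ (x `^ (m%:R^-1)) ^+ m = x.
Proof.
move=> m0 x1; have x0 : 0 <= x by lra.
have xm : (x `^ (m%:R^-1)) ^+ m = x.
  by rewrite -powR_mulrn ?powR_ge0 // -powRrM mulVf ?powRr1 // pnatr_eq0 -lt0n.
by split=> //; rewrite -(expr_ge1 m0) ?powR_ge0 // xm.
Qed.

(** [L] stands for the logarithm of the size and [LL] for [loglog]. Dividing [L] by [LL] costs its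
    logarithm only a constant factor, because [log2 LL <= LL / 2 + 2]. *)
Lemma loglog_bound (L LL : R) : 1 <= L -> LL = Num.max 1 (log2 L) ->
  [/\ 1 <= LL, LL <= L & LL <= 4 * log2 (4 * (L / LL))].
Proof.
move=> L1 def_LL.
have LL1 : 1 <= LL by rewrite def_LL le_max lexx.
have [L0 LL0] : 0 < L /\ 0 < LL by lra.
split=> //; first by rewrite def_LL ge_max L1 log2_le_id.
rewrite log2M ?divr_gt0 // log2_div // (_ : 4 = 2 ^+ 2); last by rewrite -natrX.
rewrite log2X // log2_2.
have [le_L1|lt_1L] := lerP (log2 L) 1.
  have -> : LL = 1 by rewrite def_LL max_l.
  have := log2_ge0 L1.
  rewrite /log2 ln1 mul0r; lra.
have eLL : LL = log2 L by rewrite def_LL max_r // ltW.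
have := log2_le_half LL0; rewrite eLL; lra.
Qed.

Lemma even_parameter (L : R) m : (0 < m)%N -> 1 <= L ->
  exists l : nat, L <= l%:R ^+ m /\ l%:R <= 2 * L `^ (m%:R^-1).
Proof.
move=> m0 L1; have [] := root_powR m0 L1; set X := _ `^ _ => X1 Xm.
have [l Xl lX] := nat_approx (le_trans ler01 X1); exists l; split; last by lra.
by rewrite -{1}Xm lerXn2r ?nnegrE //; lra.
Qed.

(** Take [l] within 1 above [4 * X], and [b] within 1 above twice the square root of [X]. Then
    [l ^ m] is at least [4 ^ m] times [L / LL], and [2 * log2 b >= log2 (4 * X)]. The product
    reaches [L] because [LL <= 4 * m * log2 (4 * X)] and [4 * m <= 4 ^ m]. *)
Lemma odd_parameters (L LL : R) m : (0 < m)%N -> 1 <= L ->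
  LL = Num.max 1 (log2 L) ->
  let X := (L / LL) `^ (m%:R^-1) in
  exists b l : nat, [/\ (0 < b)%N, L <= ((l ^ m).*2)%:R * log2 b%:R,
    b%:R ^+ 2 <= 9 * X, l%:R <= 5 * X & 1 <= X].
Proof.
move=> m0 L1 def_LL X; have [LL1 LL_L LL_log] := loglog_bound L1 def_LL.
have [L0 LL0] : 0 < L /\ 0 < LL by lra.
have Q1 : 1 <= L / LL by rewrite ler_pdivlMr // mul1r.
have [X1 Xm] : 1 <= X /\ X ^+ m = L / LL by exact: root_powR.
have [l Xl lX] : exists2 l : nat, 4 * X <= l%:R & l%:R <= 4 * X + 1.
  by apply: nat_approx; lra.
have s2 : Num.sqrt X ^+ 2 = X by rewrite sqr_sqrtr //; lra.
have s1 : 1 <= Num.sqrt X by rewrite -(sqrtr1 R) ler_wsqrtr.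
have [b sb bs] : exists2 b : nat, 2 * Num.sqrt X <= b%:R & b%:R <= 2 * Num.sqrt X + 1.
  by apply: nat_approx; lra.
have b0 : (0 < b)%N by rewrite -(ltr_nat R); lra.
have b2X : 4 * X <= b%:R ^+ 2 by nra.
exists b, l; split=> //; [|by nra|by lra].
have X0 : 0 < X by lra.
rewrite -muln2 natrM natrX -mulrA -(log2X 2) ?ltr0n //.
have log4X : 0 <= log2 (4 * X) by apply: log2_ge0; lra.
have lm : 4 ^+ m * (L / LL) <= l%:R ^+ m.
  by rewrite -Xm -exprMn lerXn2r ?nnegrE //; lra.
have -> : L = (L / LL) * LL by rewrite divfK // gt_eqF.
have m4 : 4 * m%:R <= (4 : R) ^+ m.
  rewrite -natrX -natrM ler_nat; case: m m0 {X Xm X1 Xl lX s2 s1 sb bs b2X X0 log4X lm} => // m _.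
  by rewrite expnS leq_mul2l /= ltn_expl.
have logs : LL <= 4 ^+ m * log2 (4 * X).
  apply: le_trans LL_log _; apply: le_trans (ler_wpM2r log4X m4).
  rewrite -mulrA ler_pM2l // -log2X; last by lra.
  rewrite ler_log2 ?exprMn ?Xm; [|lra|by rewrite mulr_gt0 ?exprn_gt0 //; lra].
  by rewrite ler_pM2r; [rewrite -{1}[4]expr1 ler_eXn2l // ; lra | lra].
have log_b : log2 (4 * X) <= log2 (b%:R ^+ 2).
  by rewrite ler_log2 // ?exprn_gt0 ?ltr0n //; lra.
have Q0 : 0 <= L / LL by lra.
apply: le_trans (ler_wpM2l Q0 logs) _.
rewrite mulrCA mulrA; apply: ler_pM => //.
by rewrite mulr_ge0 // exprn_ge0.
Qed.

End Log2.

(** * Even and odd hop-diameters *)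

Section Constructions.
Variables (V : finType) (e : rel V).
Hypothesis tree_e : is_tree e.
Variable r : V.
Local Open Scope nat_scope.

(** The first round uses [q = 2], whose separators have [q.-1 ^ 2 = 1] vertex; its [l.*2] levels
    give [(2 ^ l) ^ 2] vertices, the form that [shortcuttable_iter] takes with [b = 2 ^ l]. *)
Lemma even_shortcuttable m l :
  shortcuttable tree_e r m.+1.*2 (m.+1 * l.*2.*2) (2 ^ (l ^ m.+1).*2).
Proof.
have base : shortcuttable tree_e r 2 l.*2.*2 ((2 ^ l) ^ 2).
  rewrite -expnM muln2.
  have := @shortcuttable0 V e tree_e r.
  exact: (@shortcuttable_step _ _ tree_e r 0 0 1 2 l.*2).
have := @shortcuttable_iter _ _ _ _ 2 l.*2.*2 (2 ^ l) l m _ base.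
rewrite -expnM -(doubleMr l) -expnS -mulSn expn_gt0; exact.
Qed.

Lemma odd_shortcuttable m b l : 0 < b ->
  shortcuttable tree_e r m.*2.+1 (b ^ 2 + m * l.*2.*2) (b ^ (l ^ m).*2).
Proof.
move=> b0; apply: (@shortcuttable_iter _ _ _ _ 1 (b ^ 2)) b0 _.
exact: shortcuttable1.
Qed.

End Constructions.

Theorem theorem1p1 (R : realType) :
  forall c : R, 0 < c ->
  exists C : R, 0 < C /\
  forall n k : nat, (1 <= n)%N -> (2 <= k)%N -> k%:R <= c * loglog R n ->
  forall (V : finType) (e : rel V) (w : V -> V -> R),
    #|V| = n -> is_tree e -> edge_lengths e w ->
  exists g : rel V,
    shortcutting e w k g /\
    (treewidth g)%:R <=
      C * (k%:R *
           if odd k then (log2 (n%:R : R) / loglog R n) `^ (2 / (k.-1)%:R)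
           else (log2 (n%:R : R)) `^ (2 / k%:R)).
Proof.
(* With [X] the power in the bound, the width is at most [(9 + 20 * m) * X] for [k = 2 * m + 1] and
   [8 * m * X] for [k = 2 * m]; both are at most [15 * k * X]. *)
move=> c _; exists 15; split=> [|n k n1 k2 _ V e wt cardV tree_e _]; first by lra.
have /card_gt0P[r _] : (0 < #|V|)%N by case: tree_e.
(* For [n = 1] the logarithm is 0, while the choice of parameters asks for at least 1; the graph
   without edges serves. *)
have [le_n1|n2] := leqP n 1.
  have cardV1 : (#|[set: V]| <= 1)%N by rewrite finset.cardsT cardV.
  have [sc tw] := shortcut_data_shortcutting wt (shortcut_data1 tree_e k 0 cardV1).
  eexists; split; first exact: sc.
  rewrite (eqP (_ : treewidth _ == 0%N)) -?leqn0 //.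
  by rewrite mulr_ge0 // mulr_ge0 //; case: ifP => _; exact: powR_ge0.
have L1 : 1 <= log2 (n%:R : R) by rewrite -[leLHS](log2_2 R) ler_log2 ?ltr0n // ler_nat.
(* With [k] equal to [m.*2.+1] or [m.*2], the exponent becomes the inverse of [m]. *)
have div_double (m : nat) : 2 / (m.*2)%:R = m%:R^-1 :> R.
  by rewrite -muln2 natrM invfM mulrCA divff ?mulr1 // pnatr_eq0.
have natr_double (l : nat) : (l.*2.*2)%:R = 4 * l%:R :> R.
  by rewrite -!muln2 -mulnA natrM mulrC.
move: (odd_double_half k) k2; case: (odd k) => /= <- k2.
  have m0 : (0 < k./2)%N by case: k./2 k2.
  move: k./2 m0 => m m0 {k2}.
  have [b [l [b0 L_le b_le l_le X1]]] := odd_parameters m0 L1 (erefl _).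
  have card_le : (#|V| <= b ^ (l ^ m).*2)%N by rewrite cardV; exact: (@leq_log2_exp R).
  have [g [sc tw]] := shortcuttable_shortcutting wt
    (@odd_shortcuttable V e tree_e r m b l b0) card_le.
  exists g; split=> //; rewrite /loglog div_double.
  move: tw; rewrite -(ler_nat R) => /le_trans; apply.
  set X := _ `^ _ in b_le l_le X1 *.
  rewrite natrD natrX natrM natr_double [in leRHS]natrD -muln2 natrM.
  have ml : m%:R * l%:R <= m%:R * (5 * X) by rewrite ler_wpM2l.
  have mX : 0 <= m%:R * X by rewrite mulr_ge0 //; lra.
  lra.
case: k./2 k2 => // m _.
have [l [l_ge l_le]] := even_parameter (ltn0Sn m) L1.
have card_le : (#|V| <= 2 ^ (l ^ m.+1).*2)%N.
  rewrite cardV; apply: (@leq_log2_exp R) => //.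
  rewrite log2_2 mulr1; apply: le_trans l_ge _.
  by rewrite -natrX ler_nat -addnn leq_addr.
have [g [sc tw]] := shortcuttable_shortcutting wt (@even_shortcuttable V e tree_e r m l) card_le.
exists g; split=> //; rewrite add0n div_double.
move: tw; rewrite -(ler_nat R) => /le_trans; apply.
move: l_le; set X := _ `^ _ => l_le.
rewrite natrM natr_double -[in leRHS]muln2 natrM.
have ml : m.+1%:R * l%:R <= m.+1%:R * (2 * X) by rewrite ler_wpM2l.
have mX : 0 <= m.+1%:R * X by rewrite mulr_ge0 // powR_ge0.
lra.
Qed.
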